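(* Let $k\ge 0$ and $\upsilon\ge1$ be integers. For all real $p$ and real $q>-1$, $${}_{K}M_{k;\upsilon}^{(p,q)}(y,z)=(-1)^k k!\;{}_{K}P_{k;\upsilon}^{(q,-p-q)}(2y+1,z),\qquad {}_{K}\mathcal{M}_{k;\upsilon}^{(p,q)}(y,z)=(-1)^k k!\;Q_{k;\upsilon}^{(q,-p-q)}(2y+1,z);$$ equivalently, for all real $p>-1$ and real $q$, $${}_{K}P_{k;\upsilon}^{(p,q)}(y,z)=\frac{(-1)^k}{k!}\;{}_{K}M_{k;\upsilon}^{(-p-q,p)}\!\left(\frac{y-1}{2},z\right),\qquad Q_{k;\upsilon}^{(p,q)}(y,z)=\frac{(-1)^k}{k!}\;{}_{K}\mathcal{M}_{k;\upsilon}^{(-p-q,p)}\!\left(\frac{y-1}{2},z\right).$$ These are identities of polynomials in $y,z$.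
   Context: $(a)_n=a(a+1)\cdots(a+n-1)$, $(a)_0=1$; $1/\Gamma(x)$ is read as $0$ at $x=0,-1,-2,\dots$. M-Konhauser polynomials (first family): $${}_{K}M_{k;\upsilon}^{(p,q)}(y,z)=(-1)^k\Gamma(k+q+1)\sum_{l=0}^{k}\sum_{s=0}^{k-l}\frac{(-k)_{l+s}(k+1-p)_l(-y)^l z^{\upsilon s}}{\Gamma(l+q+1)\Gamma(\upsilon s-p-q+1)\,l!\,s!}.$$ Univariate polynomials: $$M_k^{(p,q)}(y)=(-1)^k\Gamma(k+q+1)\sum_{m=0}^{k}\frac{(-k)_m(k+1-p)_m(-y)^m}{m!\,\Gamma(m+q+1)}.$$ Konhauser polynomials: $$Y_j^{(c)}(z;\upsilon)=\frac1{j!}\sum_{i=0}^{j}\frac{z^i}{i!}\sum_{m=0}^{i}(-1)^m\binom{i}{m}\left(\frac{1+c+m}{\upsilon}\right)_j.$$ Second family: ${}_{K}\mathcal{M}_{k;\upsilon}^{(p,q)}(y,z)=M_k^{(p,q)}(y)\sum_{j=0}^{k}Y_j^{(-p-q)}(z;\upsilon)$. Bivariate Jacobi Konhauser polynomials (first family): $${}_{K}P_{k;\upsilon}^{(\alpha,\beta)}(y,z)=\frac{\Gamma(k+\alpha+1)}{k!}\sum_{l=0}^{k}\sum_{s=0}^{k-l}\frac{(-k)_{l+s}(k+\alpha+\beta+1)_l\left(\frac{1-y}{2}\right)^{l}z^{\upsilon s}}{\Gamma(l+\alpha+1)\Gamma(\upsilon s+\beta+1)\,l!\,s!}.$$ Second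 family: $Q_{k;\upsilon}^{(\alpha,\beta)}(y,z)=P_k^{(\alpha,\beta)}(y)\sum_{j=0}^{k}Y_j^{(\beta)}(z;\upsilon)$, where $$P_k^{(\alpha,\beta)}(y)=\frac{\Gamma(k+\alpha+1)}{k!}\sum_{l=0}^{k}\frac{(-k)_l(k+\alpha+\beta+1)_l}{l!\,\Gamma(l+\alpha+1)}\left(\frac{1-y}{2}\right)^l$$ is the classical Jacobi polynomial. All these formulas are used for every real parameter value for which they make sense. *)

(* Defs.v *)
From HB Require Import structures.
From mathcomp Require Import all_boot all_order all_algebra.
From mathcomp Require Import all_classical all_reals all_analysis.

Set Implicit Arguments.
Unset Strict Implicit.
Unset Printing Implicit Defensive.

Import Order.TTheory GRing.Theory Num.Theory.

Local Open Scope ring_scope.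

Section Gamma.
Context {R : realType}.
Implicit Types (x a : R) (n : nat).

(* The rising factorial (a)_n. *)
Definition poch a n : R := \prod_(i < n) (a + i%:R).

Definition Gamma_integral x : R :=
  Rintegral lebesgue_measure `]0, +oo[%classic
    (fun t : R => t `^ (x - 1) * expR (- t)).

(* Euler's integral for x > 0, extended to x <= 0 by the functional equation
   Gamma x = Gamma (x + n) / (x)_n, where n is the least natural number with
   0 < x + n. At the poles 0, -1, -2, ... the divisor (x)_n vanishes, so that
   Gamma x = 0 and (Gamma x)^-1 = 0 (see invGamma_pole): writing (Gamma x)^-1
   thus implements the reading of 1 / Gamma as 0 at the poles. *)
Definition Gamma x : R :=
  if 0 < x then Gamma_integral x
  else let n := (Num.truncn (- x)).+1 in Gamma_integral (x + n%:R) / poch x n.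

Lemma invGamma_pole n : (Gamma (- n%:R))^-1 = 0.
Proof.
rewrite /Gamma oppr_gt0 ltrn0 opprK natrK /poch big_ord_recr /= addNr mulr0.
by rewrite invr0 mulr0 invr0.
Qed.

End Gamma.

(* An element of {poly {poly R}} is a polynomial in z (the outer variable 'X)
   with coefficients polynomials in y (the inner variable 'X%:P). *)
Section Polynomials.
Context {R : realType}.
Implicit Types (k v : nat) (p q c al be : R).

Let y : {poly {poly R}} := 'X%:P.
Let z : {poly {poly R}} := 'X.

Definition subst_y (g : {poly R}) (P : {poly {poly R}}) : {poly {poly R}} :=
  map_poly (comp_poly g) P.

Definition M_Konhauser1 k v p q : {poly {poly R}} :=
  ((-1) ^+ k * Gamma (k%:R + q + 1))%:P%:P *
  \sum_(l < k.+1) \sum_(s < (k - l).+1)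
    (poch (- k%:R) (l + s) * poch (k%:R + 1 - p) l
       * (Gamma (l%:R + q + 1))^-1
       * (Gamma ((v * s)%:R - p - q + 1))^-1
       / (l`!%:R * s`!%:R))%:P%:P
    * (- y) ^+ l * z ^+ (v * s).

Definition M_univ k p q : {poly R} :=
  ((-1) ^+ k * Gamma (k%:R + q + 1))%:P *
  \sum_(m < k.+1)
    (poch (- k%:R) m * poch (k%:R + 1 - p) m
       * (Gamma (m%:R + q + 1))^-1 / m`!%:R)%:P
    * (- 'X) ^+ m.

Definition Konhauser j c v : {poly R} :=
  (j`!%:R^-1)%:P *
  \sum_(i < j.+1)
    (i`!%:R^-1 *
     \sum_(m < i.+1)
       (-1) ^+ m * 'C(i, m)%:R * poch ((1 + c + m%:R) / v%:R) j)%:P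
    * 'X ^+ i.

(* A polynomial a in y embeds as a%:P, a polynomial b in z as b^:P. *)
Definition M_Konhauser2 k v p q : {poly {poly R}} :=
  (M_univ k p q)%:P *
  \sum_(j < k.+1) map_poly polyC (Konhauser j (- p - q) v).

Definition Jacobi_Konhauser1 k v al be : {poly {poly R}} :=
  (Gamma (k%:R + al + 1) / k`!%:R)%:P%:P *
  \sum_(l < k.+1) \sum_(s < (k - l).+1)
    (poch (- k%:R) (l + s) * poch (k%:R + al + be + 1) l
       * (Gamma (l%:R + al + 1))^-1
       * (Gamma ((v * s)%:R + be + 1))^-1
       / (l`!%:R * s`!%:R))%:P%:P
    * ((2^-1)%:P%:P * (1 - y)) ^+ l * z ^+ (v * s).

Definition Jacobi k al be : {poly R} :=
  (Gamma (k%:R + al + 1) / k`!%:R)%:P *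
  \sum_(l < k.+1)
    (poch (- k%:R) l * poch (k%:R + al + be + 1) l
       * (Gamma (l%:R + al + 1))^-1 / l`!%:R)%:P
    * ((2^-1)%:P * (1 - 'X)) ^+ l.

Definition Jacobi_Konhauser2 k v al be : {poly {poly R}} :=
  (Jacobi k al be)%:P *
  \sum_(j < k.+1) map_poly polyC (Konhauser j be v).

End Polynomials.

(* Main.v *)
Require Import Defs.
From HB Require Import structures.
From mathcomp Require Import all_boot all_order all_algebra.
From mathcomp Require Import all_classical all_reals all_analysis.
From mathcomp Require Import ring.

(** The affine change of variable y -> 2y + 1 turns the Jacobi argument
    (1 - y) / 2 into - y, the argument of the M-polynomials.  With
    (alpha, beta) = (q, - p - q) the parameters match as well:
    k + alpha + beta + 1 = k + 1 - p and beta + 1 = - p - q + 1.  Hence both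
    sides of the first pair of identities agree term by term, the factor
    (-1)^k k! accounting for the difference in normalization
    ([M_Konhauser1_Jacobi], [M_Konhauser2_Jacobi]).

    The second pair is the inverse form of the first: the reparametrization
    (p, q) |-> (- p - q, p) sends (q, - p - q) to (p, q), and
    y -> (y - 1) / 2 undoes y -> 2y + 1 ([subst_y_solve]). *)

Set Implicit Arguments.
Unset Strict Implicit.
Unset Printing Implicit Defensive.

Import Order.TTheory GRing.Theory Num.Theory.

Local Open Scope ring_scope.

Section Substitution.
Context {R : realType}.
Implicit Types (g h a : {poly R}) (P Q : {poly {poly R}}).

Lemma subst_yM g P Q : subst_y g (P * Q) = subst_y g P * subst_y g Q.
Proof. exact: rmorphM. Qed.

Lemma subst_yC g a : subst_y g a%:P = (a \Po g)%:P.
Proof. exact: map_polyC. Qed.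

Lemma subst_yXn g n : subst_y g ('X ^+ n) = 'X ^+ n.
Proof. by rewrite /subst_y rmorphXn /= map_polyX. Qed.

Lemma subst_y_sum g n (F : 'I_n -> {poly {poly R}}) :
  subst_y g (\sum_(i < n) F i) = \sum_(i < n) subst_y g (F i).
Proof. exact: rmorph_sum. Qed.

Lemma subst_y_liftz g (b : {poly R}) :
  subst_y g (map_poly polyC b) = map_poly polyC b.
Proof.
rewrite /subst_y -map_poly_comp.
by apply: eq_map_poly => c /=; rewrite comp_polyC.
Qed.

Lemma subst_y_inv g h P : h \Po g = 'X -> subst_y g (subst_y h P) = P.
Proof.
move=> hg; apply/polyP => i.
by rewrite /subst_y !coef_map /= -comp_polyA hg comp_polyXr.
Qed.

End Substitution.

Section Main.
Context {R : realType}.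
Implicit Types (k v : nat) (p q : R).

Let up : {poly R} := 2%:P * 'X + 1.
Let down : {poly R} := (2^-1)%:P * ('X - 1).

(** This is the change of variable behind the theorem: the Jacobi argument
    becomes the argument of the M-polynomials. *)
Lemma half_sub_comp : ((2^-1)%:P * (1 - 'X)) \Po up = - 'X :> {poly R}.
Proof.
have h : (2^-1)%:P * 2%:P = 1 :> {poly R}.
  by rewrite -polyCM mulVf ?pnatr_eq0.
rewrite comp_polyM comp_polyC comp_polyB comp_polyX -polyC1 comp_polyC /up polyC1.
rewrite mulrBr mulrDr mulrA h; ring.
Qed.

Lemma up_down_comp : up \Po down = 'X.
Proof.
have h : (2^-1)%:P * 2%:P = 1 :> {poly R}.
  by rewrite -polyCM mulVf ?pnatr_eq0.
rewrite /up comp_polyD comp_polyM comp_polyX -polyC1 !comp_polyC /down polyC1.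
rewrite mulrA [2%:P * _]mulrC h; ring.
Qed.

Lemma Jacobi_param k p q : k%:R + q + (- p - q) + 1 = k%:R + 1 - p.
Proof. by ring. Qed.

Lemma M_univ_Jacobi k p q :
  M_univ k p q = ((-1) ^+ k * k`!%:R)%:P * (Jacobi k q (- p - q) \Po up).
Proof.
have fk : k`!%:R != 0 :> R by rewrite pnatr_eq0 -lt0n fact_gt0.
rewrite /M_univ /Jacobi comp_polyM comp_polyC mulrA -polyCM.
congr (_%:P * _); first by field.
rewrite rmorph_sum; apply: eq_bigr => l _ /=.
rewrite comp_polyM comp_polyC rmorphXn /= half_sub_comp.
by rewrite Jacobi_param.
Qed.

(** The coefficients already agree for each (l, s), the Pochhammer and Gamma
    factors having equal arguments on the two sides. *)
Lemma M_Konhauser1_Jacobi k v p q :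
  M_Konhauser1 k v p q
    = ((-1) ^+ k * k`!%:R)%:P%:P
        * subst_y up (Jacobi_Konhauser1 k v q (- p - q)).
Proof.
have fk : k`!%:R != 0 :> R by rewrite pnatr_eq0 -lt0n fact_gt0.
rewrite /M_Konhauser1 /Jacobi_Konhauser1 subst_yM subst_yC comp_polyC.
rewrite mulrA -!polyCM; congr (_%:P%:P * _); first by field.
rewrite subst_y_sum; apply: eq_bigr => l _.
rewrite subst_y_sum; apply: eq_bigr => s _.
rewrite !subst_yM subst_yXn subst_yC comp_polyC.
rewrite -polyC1 -polyCB -polyCM -rmorphXn subst_yC rmorphXn /=.
rewrite half_sub_comp -polyCN -rmorphXn /=.
by rewrite Jacobi_param [_ + (- p - q)]addrA.
Qed.

(** The Konhauser factor has the same index - p - q on both sides and does not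
    involve y, so that only the univariate factor has to be compared. *)
Lemma M_Konhauser2_Jacobi k v p q :
  M_Konhauser2 k v p q
    = ((-1) ^+ k * k`!%:R)%:P%:P
        * subst_y up (Jacobi_Konhauser2 k v q (- p - q)).
Proof.
rewrite /M_Konhauser2 /Jacobi_Konhauser2 subst_yM subst_yC mulrA -polyCM.
rewrite -M_univ_Jacobi subst_y_sum; congr (_ * _).
by apply: eq_bigr => j _; rewrite subst_y_liftz.
Qed.

(** Solving for the Jacobi side: [down] is inverse to [up] and the constants
    (-1)^k k! and (-1)^k / k! are inverse to each other. *)
Lemma subst_y_solve k (P Q : {poly {poly R}}) :
  P = ((-1) ^+ k * k`!%:R)%:P%:P * subst_y up Q ->
  Q = ((-1) ^+ k / k`!%:R)%:P%:P * subst_y down P.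
Proof.
have fk : k`!%:R != 0 :> R by rewrite pnatr_eq0 -lt0n fact_gt0.
move=> ->; rewrite subst_yM subst_yC comp_polyC.
rewrite (subst_y_inv _ up_down_comp) mulrA -!polyCM.
suff -> : (-1) ^+ k / k`!%:R * ((-1) ^+ k * k`!%:R) = 1 :> R by rewrite mul1r.
by rewrite mulrCA divfK // -expr2 sqrr_sign.
Qed.

End Main.

Theorem theorem10 (R : realType) (k v : nat) (hv : (1 <= v)%N) :
  (forall p q : R, -1 < q ->
     M_Konhauser1 k v p q
       = ((-1) ^+ k * k`!%:R)%:P%:P
           * subst_y (2%:P * 'X + 1) (Jacobi_Konhauser1 k v q (- p - q))
  /\ M_Konhauser2 k v p q
       = ((-1) ^+ k * k`!%:R)%:P%:P
           * subst_y (2%:P * 'X + 1) (Jacobi_Konhauser2 k v q (- p - q)))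
  /\
  (forall p q : R, -1 < p ->
     Jacobi_Konhauser1 k v p q
       = ((-1) ^+ k / k`!%:R)%:P%:P
           * subst_y ((2^-1)%:P * ('X - 1)) (M_Konhauser1 k v (- p - q) p)
  /\ Jacobi_Konhauser2 k v p q
       = ((-1) ^+ k / k`!%:R)%:P%:P
           * subst_y ((2^-1)%:P * ('X - 1)) (M_Konhauser2 k v (- p - q) p)).
Proof.
split=> p q _.
  by split; [exact: M_Konhauser1_Jacobi | exact: M_Konhauser2_Jacobi].
(* The goals are the first pair at (- p - q, p), solved for the Jacobi side. *)
have e : q = - (- p - q) - p by ring.
split; apply: subst_y_solve; rewrite {2}e.
- exact: M_Konhauser1_Jacobi.
- exact: M_Konhauser2_Jacobi.
Qed.
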